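(* Let $(X,d)$ be a compact metric space, let $C$ be a closed subset of $X$, and let $\tau_{k|C}$ be the associated collection of subsets of $H(X)$ (defined in the context). Then the following hold: (1) $\tau_{k|C}$ is a group topology on $H(X)$ provided $C$ is $H(X)$-invariant (that is, $h(C)=C$ for all $h\in H(X)$); (2) $\tau_{k|C}$ is $T_0$ if $C$ is closed nowhere dense; and (3) $\tau_{k|C}\subseteq\tau_k$, with equality if and only if for every $\epsilon>0$ there is a $\delta$ with $0<\delta\le\epsilon$ such that: if $h\in H(X)$ satisfies $d(h(x),x)<\delta$ and $d(h^{-1}(x),x)<\delta$ for all $x\notin C_\delta$, then $d(h(x),x)<\epsilon$ and $d(h^{-1}(x),x)<\epsilon$ for all $x\in C_\delta$.
   Context: $H(X)$ denotes the group of all homeomorphisms of $X$ onto itself under composition, and $\tau_k$ is the compact-open topology on $H(X)$, whose basic neighborhoods of the identity are the sets $\{f\in H(X): d(f(x),x)<\epsilon\text{ for all }x\in X\}$, $\epsilon>0$. A topology on a group is a group topology if the group operations are continuous for it. For a closed set $C\subseteq X$ and $\epsilon>0$, $C_\epsilon=\{x\in X: d(x,C)<\epsilon\}$ (with $C_\epsilon=\emptyset$ if $C=\emptyset$), and $$B_\epsilon^{\tau_{k|C}}=\{h\in H(X): d(h(x),x)<\epsilon \text{ and } d(h^{-1}(x),x)<\epsilon \text{ for all } x\in X\setminus C_\epsilon\}.$$ $\tau_{k|C}$ is the collection of all unions of translates $gB_\epsilon^{\tau_{k|C}}$ ($g\in H(X)$, $\epsilon>0$). The collection $\tau_{k|C}$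 does not depend on the choice of compatible metric $d$. Saying that $\tau_{k|C}$ is $T_0$ means that for any two distinct elements of $H(X)$ some member of $\tau_{k|C}$ contains exactly one of them. *)

(* Defs.v *)
From HB Require Import structures.
From mathcomp Require Import all_boot all_order all_algebra.
From mathcomp Require Import all_classical all_reals all_analysis.

Set Implicit Arguments.
Unset Strict Implicit.
Unset Printing Implicit Defensive.

Import Order.TTheory GRing.Theory Num.Theory.

Local Open Scope classical_set_scope.
Local Open Scope ring_scope.

Record homeo (X : topologicalType) := Homeo {
  homeo_fun :> X -> X ;
  homeo_inv : X -> X ;
  homeo_funK : cancel homeo_fun homeo_inv ;
  homeo_invK : cancel homeo_inv homeo_fun ;
  homeo_fun_continuous : continuous homeo_fun ;
  homeo_inv_continuous : continuous homeo_inv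
}.

Section HomeoGroup.
Variable X : topologicalType.
Implicit Types f g h : homeo X.

Lemma homeoP f g : homeo_fun f =1 homeo_fun g -> f = g.
Proof.
case: f => f f' fK f'K fc f'c; case: g => g g' gK g'K gc g'c /= fg.
have {fg} efg : f = g by apply/funext.
subst g.
have efg' : f' = g' by apply/funext => x; rewrite -{1}(g'K x) fK.
subst g'.
by congr Homeo; exact: Prop_irrelevance.
Qed.

Definition homeo_one : homeo X :=
  @Homeo X id id (fun=> erefl) (fun=> erefl) (fun=> cvg_id) (fun=> cvg_id).

Definition homeo_V f : homeo X :=
  Homeo (@homeo_invK X f) (@homeo_funK X f)
        (@homeo_inv_continuous X f) (@homeo_fun_continuous X f).

Lemma homeo_comp_continuous f g : continuous (f \o g).
Proof.
by move=> x; apply: continuous_comp; exact: homeo_fun_continuous.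
Qed.

Lemma homeo_comp_inv_continuous f g :
  continuous (homeo_inv g \o homeo_inv f).
Proof.
by move=> x; apply: continuous_comp; exact: homeo_inv_continuous.
Qed.

Definition homeo_comp f g : homeo X :=
  Homeo (can_comp (@homeo_funK X f) (@homeo_funK X g))
        (can_comp (@homeo_invK X g) (@homeo_invK X f))
        (@homeo_comp_continuous f g) (@homeo_comp_inv_continuous f g).

Lemma homeo_compA : associative homeo_comp.
Proof. by move=> f g h; exact: homeoP. Qed.

Lemma homeo_comp1h : left_id homeo_one homeo_comp.
Proof. by move=> f; exact: homeoP. Qed.

Lemma homeo_comph1 : right_id homeo_one homeo_comp.
Proof. by move=> f; exact: homeoP. Qed.

Lemma homeo_compVh : left_inverse homeo_one homeo_V homeo_comp.
Proof. by move=> f; apply: homeoP => x /=; rewrite homeo_funK. Qed.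

Lemma homeo_comphV : right_inverse homeo_one homeo_V homeo_comp.
Proof. by move=> f; apply: homeoP => x /=; rewrite homeo_invK. Qed.

HB.instance Definition _ := gen_eqMixin (homeo X).
HB.instance Definition _ := gen_choiceMixin (homeo X).
HB.instance Definition _ := isGroup.Build (homeo X)
  homeo_compA homeo_comp1h homeo_comph1 homeo_compVh homeo_comphV.

End HomeoGroup.

Definition nowhere_dense (T : topologicalType) (A : set T) : Prop :=
  interior (closure A) = set0.

Definition homeo_invariant (X : topologicalType) (C : set X) : Prop :=
  forall h : homeo X, [set h x | x in C] = C.

(* The empty set is open as the union of the empty family. *)
Definition is_topology (T : Type) (tau : set (set T)) : Prop :=
  [/\ tau setT,
      setI_closed tau &
      forall F : set (set T), F `<=` tau -> tau (\bigcup_(A in F) A)].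

Definition is_group_topology (G : groupType) (tau : set (set G)) : Prop :=
  [/\ is_topology tau,
      forall (W : set G) (f g : G), tau W -> W (f * g)%g ->
        exists U V : set G, [/\ tau U, tau V, U f, V g &
          forall u v : G, U u -> V v -> W (u * v)%g] &
      forall W : set G, tau W -> tau [set g | W (g^-1)%g]].

Definition is_T0 (T : Type) (tau : set (set T)) : Prop :=
  forall x y : T, x <> y ->
    exists2 U, tau U & (U x /\ ~ U y) \/ (U y /\ ~ U x).

(* The trace on the homeomorphism group of the compact-open topology of
   the space of all functions from X to X. *)
Definition tau_k (X : topologicalType) : set (set (homeo X)) :=
  @open (initial_topology
           (fun h : homeo X => (homeo_fun h : {compact-open, X -> X}))).
Arguments tau_k : clear implicits.

(* The infimum is taken in the extended reals, so it is +oo for C empty and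
   the neighborhood is then empty. *)
Definition metric_nbhd (R : realType) (X : metricType R) (C : set X) (e : R) :
    set X :=
  [set x | (ereal_inf [set (mdist x c)%:E | c in C] < e%:E)%E].

Definition ball_kC (R : realType) (X : metricType R) (C : set X) (e : R) :
    set (homeo X) :=
  [set h : homeo X | forall x, ~ metric_nbhd C e x ->
     mdist (h x) x < e /\ mdist ((h^-1)%g x) x < e].

Definition tau_kC (R : realType) (X : metricType R) (C : set X) :
    set (set (homeo X)) :=
  [set O | exists I : set (homeo X * R),
     (forall p, I p -> 0 < p.2) /\
     O = \bigcup_(p in I) [set (p.1 * h)%g | h in ball_kC C p.2]].

(* Main.v *)
Require Import Defs.
From mathcomp Require Import all_boot all_order all_algebra.
From mathcomp Require Import all_classical all_reals all_analysis.
From mathcomp Require Import lra.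

Set Implicit Arguments.
Unset Strict Implicit.
Unset Printing Implicit Defensive.

Import Order.TTheory GRing.Theory Num.Theory.

Local Open Scope classical_set_scope.
Local Open Scope ring_scope.

(** The neighborhoods [ball_kC C e] of the identity control a homeomorphism
    and its inverse only on the compact complement of the open e-neighborhood
    of C.  Everything rests on compactness, used in one form: a property which
    near each point of a compact set holds for all small radii holds for all
    small radii uniformly on that set ([compact_near_radius]).  It yields
    uniform continuity, the stability of a strict displacement bound
    [mdist (f x) x < e] on a compact set ([near_displacement]), and a positive
    distance between the image of a compact set and a closed set which it
    does not meet ([near_image_avoids]).

    For compact X, a set is open in the compact-open topology on the
    homeomorphism group when it contains a ball for the uniform distance
    around each of its elements ([tau_kP]).

    (1) Suppose that C is invariant.  Because a homeomorphism h does not send a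
    point off C into C, the image under h of the complement of a neighborhood
    of C is at positive distance from C.  Hence each element b of
    [ball_kC C e] has a translate [b * ball_kC C r] contained in that ball
    ([ball_kC_open]), so that membership in [tau_kC C] is a local condition
    ([tau_kCP]); and conjugates of small balls are contained in a given ball
    ([ball_kC_conj]).  With symmetry and [ball_kCM] these are the usual
    axioms of a neighborhood base of the identity for a group topology.

    (2) Two homeomorphisms which agree off a closed nowhere dense set are
    equal by continuity; if they differ at a point off C, a small ball
    separates them.

    (3) The bounds which define [ball_kC C e] are strict and bear on a compact
    set, so they survive a uniformly small perturbation of the homeomorphism
    ([ball_kC_unif_open]), and [tau_kC C] is coarser than the compact-open
    topology.  Since the ball for the empty set, [ball_kC set0 e], is the
    uniform ball of both the homeomorphism and its inverse, equality means that
    each [ball_kC set0 e] contains some [ball_kC C d], and this is the stated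
    condition once d is taken at most e.  No invariance of C is available
    here, so a member of [tau_kC C] containing the identity is only known to
    contain a translate [g * ball_kC C d] through the identity; the
    translation by g is absorbed by halving e ([tau_k_subset_tau_kC]). *)

(** * Compactness estimates in a metric space *)

Section MetricCompactness.
Variables (R : realType) (X : metricType R).
Implicit Types (x y z : X) (r s e : R) (C K : set X) (f : X -> X).

Lemma nbhs_mdistE x (A : set X) :
  nbhs x A <-> exists2 r, 0 < r & forall y, mdist x y < r -> A y.
Proof.
rewrite -nbhs_ballE; split=> -[r /= r0 rA]; exists r => //.
  by move=> y xy; apply: rA; rewrite ballEmdist.
by move=> y; rewrite ballEmdist => /rA.
Qed.

Lemma continuous_mdistP f : continuous f -> forall x e, 0 < e ->
  exists2 r, 0 < r & forall y, mdist x y < r -> mdist (f x) (f y) < e.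
Proof.
move=> fc x e e0.
have /fc/nbhs_mdistE// : nbhs (f x) [set z | mdist (f x) z < e].
by apply/nbhs_mdistE; exists e.
Qed.

Lemma open_mdist_ball x r : open [set y | mdist x y < r].
Proof.
rewrite openE => y /= xy; apply/nbhs_mdistE; exists (r - mdist x y).
  by rewrite subr_gt0.
move=> z yz /=; have := metric_triangle x y z; lra.
Qed.

(** The local hypothesis bounds the variation of the point and of the radius
    by the same s, which makes the product neighborhood required by
    [compact_near_coveringP] immediate. *)
Lemma compact_near_radius K (P : R -> X -> Prop) : compact K ->
  (forall x, K x -> exists2 s, 0 < s &
    forall r y, 0 < r -> r < s -> mdist x y < s -> P r y) ->
  \forall r \near 0^'+, forall x, K x -> P r x.
Proof.
move=> /compact_near_coveringP Kc KP.
apply: (Kc R 0^'+ P) => x /KP[s s0 sP].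
exists ([set y | mdist x y < s], [set r | 0 < r < s]).
  split => /=; first by apply/nbhs_mdistE; exists s.
  by near=> r; apply/andP; split => //; near: r; exact: nbhs_right_lt.
by move=> [y r] /= [xy /andP[r0 rs]]; exact: sP.
Unshelve. all: by end_near. Qed.

(** For empty C both sides are false, as the infimum is then infinite. *)
Lemma metric_nbhdP C e x :
  metric_nbhd C e x <-> exists2 c, C c & mdist x c < e.
Proof.
split=> [|[c Cc xc]].
  by move=> /ereal_inf_lt[_ [c Cc <-]]; rewrite lte_fin; exists c.
apply: (@le_lt_trans _ _ (mdist x c)%:E); last by rewrite lte_fin.
by apply: ereal_inf_lbound; exists c.
Qed.

Lemma metric_nbhd_le C r e : r <= e -> metric_nbhd C r `<=` metric_nbhd C e.
Proof.
by move=> re x /metric_nbhdP[c Cc xc]; apply/metric_nbhdP;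
  exists c => //; exact: lt_le_trans re.
Qed.

Lemma subset_metric_nbhd C e : 0 < e -> C `<=` metric_nbhd C e.
Proof.
by move=> e0 x Cx; apply/metric_nbhdP; exists x => //; rewrite mdistxx.
Qed.

Lemma metric_nbhd_open C e : open (metric_nbhd C e).
Proof.
have -> : metric_nbhd C e = \bigcup_(c in C) [set y | mdist c y < e].
  apply/seteqP; split=> x.
    by move=> /metric_nbhdP[c Cc xc]; exists c => //=; rewrite metric_sym.
  move=> [c Cc /= cx]; apply/metric_nbhdP; exists c => //.
  by rewrite metric_sym.
by apply: bigcup_open => c _; exact: open_mdist_ball.
Qed.

Lemma closed_metric_nbhd C x : closed C -> ~ C x ->
  exists2 s, 0 < s & ~ metric_nbhd C s x.
Proof.
move=> Ccl nCx; have /nbhs_mdistE[s s0 sC] : nbhs x (~` C).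
  by apply: open_nbhs_nbhs; split=> //; exact: closed_openC.
by exists s => // /metric_nbhdP[c Cc /sC].
Qed.

Lemma near_image_avoids K C f : compact K -> closed C -> continuous f ->
  (forall x, K x -> ~ C (f x)) ->
  \forall r \near 0^'+, forall x, K x -> ~ metric_nbhd C r (f x).
Proof.
move=> Kc Ccl fc KC; apply: compact_near_radius => // x /KC nC.
have [s s0 nCs] := closed_metric_nbhd Ccl nC.
have [|t t0 ft] := continuous_mdistP fc x (e := s / 2); first lra.
exists (Num.min t (s / 2)); first by rewrite lt_min t0; lra.
move=> r y r0; rewrite !lt_min => /andP[_ rs] /andP[/ft fxy _].
move=> /metric_nbhdP[c Cc yc]; apply: nCs; apply/metric_nbhdP; exists c => //.
have := metric_triangle (f x) (f y) c; lra.
Qed.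

(** Two perturbations are allowed at once, since both occur below: moving the
    argument of f ([w] instead of [x]) and moving its value ([z] instead of
    [f w]). *)
Lemma near_displacement K f e : compact K -> continuous f ->
  (forall x, K x -> mdist (f x) x < e) ->
  \forall r \near 0^'+, forall x, K x ->
    forall w z, mdist w x < r -> mdist z (f w) < r -> mdist z x < e.
Proof.
move=> Kc fc Ke; apply: compact_near_radius => // x /Ke fxe.
(* The gap left by the strict bound is shared between the distances from z
   to [f w], from [f w] to [f x], and from x to y. *)
have [|t t0 ft] := continuous_mdistP fc x (e := (e - mdist (f x) x) / 3).
  lra.
exists (Num.min (t / 2) ((e - mdist (f x) x) / 3)); first by rewrite lt_min; lra.
move=> r y r0; rewrite !lt_min => /andP[rt re] /andP[xy xye] w z wy zw.
have xw : mdist (f x) (f w) < (e - mdist (f x) x) / 3.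
  apply: ft; have := metric_triangle x y w; rewrite (metric_sym y w); lra.
have := metric_triangle z (f w) y; have := metric_triangle (f w) (f x) y.
have := metric_triangle (f x) x y; rewrite (metric_sym (f w) (f x)); lra.
Qed.

Lemma near_unif_continuous f e : compact [set: X] -> continuous f -> 0 < e ->
  \forall r \near 0^'+, forall x y, mdist x y < r -> mdist (f x) (f y) < e.
Proof.
move=> Xc fc e0.
have : \forall r \near 0^'+, forall x, [set: X] x ->
    forall y, mdist x y < r -> mdist (f x) (f y) < e.
  apply: compact_near_radius => // x _.
  have [|t t0 ft] := continuous_mdistP fc x (e := e / 2); first lra.
  exists (t / 2); first lra.
  move=> r y r0 rt xy z yz.
  have h1 : mdist (f x) (f y) < e / 2 by apply: ft; lra.
  have h2 : mdist (f x) (f z) < e / 2.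
    by apply: ft; have := metric_triangle x y z; lra.
  by have := metric_triangle (f y) (f x) (f z);
     rewrite (metric_sym (f y) (f x)); lra.
by apply: filterS => r h x; exact: h.
Qed.

End MetricCompactness.

(** * The compact-open topology on a compact space is the uniform topology *)

Section CompactOpen.
Variables (R : realType) (X : metricType R).
Hypothesis Xcompact : compact [set: X].

(** Around each x, the functions which send the compact set [closure A], on
    which h is within r / 2 of [h x], into the open ball of radius r / 2 at
    [h x] are within r of h on A; the sets A cover the compact space X. *)
Lemma nbhs_compact_open_unif (h : X -> X) (r : R) : continuous h -> 0 < r ->
  nbhs (h : {compact-open, X -> X})
    [set g : {compact-open, X -> X} | forall x, mdist (h x) (g x) < r].
Proof.
move=> hc r0.
have /compact_near_coveringP cov := Xcompact.
have : \forall g \near (h : {compact-open, X -> X}),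
    [set: X] `<=` (fun x => mdist (h x) (g x) < r).
  apply: (cov {compact-open, X -> X} (nbhs (h : {compact-open, X -> X}))
    (fun g x => mdist (h x) (g x) < r)) => x _.
  pose A := h @^-1` [set y | mdist (h x) y < r / 4].
  pose O := [set y | mdist (h x) y < r / 2].
  have KO : h @` closure A `<=` O.
    move=> _ [y Ay <-]; have r4 : 0 < r / 4 by lra.
    have /hc/Ay[y' /= [xy' yy']] : nbhs (h y) [set z | mdist (h y) z < r / 4].
      by apply/nbhs_mdistE; exists (r / 4).
    rewrite /O/=; rewrite /A/= in xy'.
    have := metric_triangle (h x) (h y') (h y); rewrite (metric_sym (h y') (h y)).
    lra.
  exists (A, [set g | g @` closure A `<=` O]).
    split => /=.
      apply: (hc x [set y | mdist (h x) y < r / 4]).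
      apply/nbhs_mdistE; exists (r / 4) => //; lra.
    apply: open_nbhs_nbhs; split => //; apply: compact_open_open.
      exact: subclosed_compact (@closed_closure _ A) Xcompact _.
    exact: open_mdist_ball.
  move=> [y g] /= [Ay gO].
  have cy : closure A y by exact: subset_closure.
  have gy : O (g y) by apply: gO; exists y.
  have hy : O (h y) by apply: KO; exists y.
  have := metric_triangle (h y) (h x) (g y); rewrite (metric_sym (h y) (h x)).
  rewrite /O/= in gy hy; lra.
by apply: filterS => g hg x; exact: hg.
Qed.

Lemma tau_kP (W : set (homeo X)) : tau_k X W <->
  forall h, W h -> exists2 r : R, 0 < r &
    forall k : homeo X, (forall x, mdist (h x) (k x) < r) -> W k.
Proof.
split=> [[A Aop <-] h Ah|hW].
  pose F : set_system {compact-open, X -> X} := filter_from [set r : R | 0 < r]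
    (fun r => [set g | forall x, mdist (h x) (g x) < r]).
  have FF : Filter F.
    apply: filter_from_filter; first by exists 1 => /=.
    move=> r s /= r0 s0; exists (Num.min r s); first by rewrite /= lt_min r0.
    by move=> g /= hg; split=> x; have := hg x; rewrite lt_min => /andP[].
  (* The filter of uniform neighborhoods of h converges to h in the
     compact-open topology, so the neighborhood A belongs to it. *)
  have : F --> (homeo_fun h : {compact-open, X -> X}).
    apply/compact_open_cvgP => K O Kc Oo hKO.
    have : \forall r \near 0^'+, forall x, K x ->
        forall z, mdist (h x) z < r -> O z.
      apply: compact_near_radius => // x Kx.
      have /nbhs_mdistE[s s0 sO] : nbhs (h x) O.
        by apply: open_nbhs_nbhs; split=> //; apply: hKO; exists x.
      have hc := @homeo_fun_continuous _ h.
      have [|t t0 ft] := continuous_mdistP hc x (e := s / 2); first lra.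
      exists (Num.min t (s / 2)); first by rewrite lt_min t0; lra.
      move=> r y r0; rewrite !lt_min => /andP[_ rs] /andP[/ft hxy _] z yz.
      by apply: sO; have := metric_triangle (h x) (h y) z; lra.
    move=> near_r; near (0:R)^'+ => r.
    exists r => //= g hg _ [x Kx <-].
    have: forall x, K x -> forall z, mdist (h x) z < r -> O z by near: r.
    by move=> /(_ x Kx _ (hg x)).
  move=> /(_ A (open_nbhs_nbhs (conj Aop Ah))) [r r0 rA].
  by exists r => // k hk; apply: rA.
rewrite /tau_k openE => h /hW[r r0 rW].
pose F (k : homeo X) : {compact-open, X -> X} := homeo_fun k.
have : nbhs (h : initial_topology F)
    (F @^-1` [set g | forall x, mdist (h x) (g x) < r]).
  apply: (@initial_continuous _ _ F h); apply: nbhs_compact_open_unif => //.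
  exact: homeo_fun_continuous.
by apply: filterS => k /= hk; exact: rW.
Unshelve. all: by end_near. Qed.

End CompactOpen.


(** * The sets ball_kC and their left translates *)

Section PartialUniform.
Variables (R : realType) (X : metricType R).
Hypothesis Xcompact : compact [set: X].
Variable C : set X.
Implicit Types (f g h k b : homeo X) (W : set (homeo X)) (r s e : R).

Lemma ball_kC1 e : 0 < e -> ball_kC C e 1%g.
Proof. by move=> e0 x _; rewrite invg1 /= mdistxx. Qed.

Lemma ball_kCV e h : ball_kC C e h -> ball_kC C e (h^-1)%g.
Proof. by move=> hB x /hB[? ?]; rewrite invgK. Qed.

Lemma ball_kC_le r e : r <= e -> ball_kC C r `<=` ball_kC C e.
Proof.
move=> re h hB x nx; have /hB[? ?] : ~ metric_nbhd C r x.
  by move=> /(metric_nbhd_le re).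
by split; lra.
Qed.

(** Off the e-neighborhood of C, a displacement smaller than e / 2 keeps the
    point off the e / 2-neighborhood, where the second map is controlled. *)
Lemma ball_kCM e g h :
  ball_kC C (e / 2) g -> ball_kC C (e / 2) h -> ball_kC C e (g * h)%g.
Proof.
move=> + + x nx.
have half k l : ball_kC C (e / 2) k -> ball_kC C (e / 2) l ->
    mdist (k (l x)) x < e.
  move=> kB lB.
  have lx : mdist (l x) x < e / 2.
    case: (pselect (metric_nbhd C (e / 2) x)) => [|/lB[]//].
    move=> /metric_nbhdP[c Cc xc]; case: nx; apply/metric_nbhdP; exists c => //.
    by have := mdist_ge0 x c; lra.
  have nlx : ~ metric_nbhd C (e / 2) (l x).
    move=> /metric_nbhdP[c Cc lxc]; apply: nx; apply/metric_nbhdP; exists c => //.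
    have := metric_triangle x (l x) c; rewrite (metric_sym x (l x)); lra.
  have [klx _] := kB _ nlx.
  by have := metric_triangle (k (l x)) (l x) x; lra.
move=> gB hB; split; first exact: half.
by rewrite invgM; apply: (half (h^-1)%g (g^-1)%g); exact: ball_kCV.
Qed.

Lemma compact_setC_metric_nbhd e : compact (~` metric_nbhd C e).
Proof.
apply: subclosed_compact Xcompact _ => //.
by apply: open_closedC; exact: metric_nbhd_open.
Qed.

(** The inverse of k is treated without inverting uniform convergence:
    [k^-1 x] is the image under [b^-1] of the point [b (k^-1 x)], which is
    close to [k (k^-1 x) = x]. *)
Lemma ball_kC_unif_open e b : ball_kC C e b ->
  \forall r \near 0^'+, forall k,
    (forall x, mdist (b x) (k x) < r) -> ball_kC C e k.
Proof.
move=> bB; have Kc := @compact_setC_metric_nbhd e.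
have nb := near_displacement Kc (@homeo_fun_continuous _ b)
  (fun x nx => (bB x nx).1).
have nbV := near_displacement Kc (@homeo_inv_continuous _ b)
  (fun x nx => (bB x nx).2).
have : \forall r \near (0:R)^'+, 0 < r by exact: nbhs_right_gt.
move: nb nbV; apply: filterS3 => r near_b near_bV r0.
move=> k bk x nx; split.
  apply: (near_b x nx x) => //; first by rewrite mdistxx.
  by rewrite metric_sym.
apply: (near_bV x nx (b ((k^-1)%g x))) => //.
  by have := bk ((k^-1)%g x); rewrite /= homeo_invK.
by rewrite /= homeo_funK mdistxx.
Qed.

Lemma tau_kC_subset_tau_k : tau_kC C `<=` tau_k X.
Proof.
move=> _ [I [I0 ->]]; apply/(tau_kP Xcompact) => h [[g e] Ige [b bB <-{h}]].
have near_b := ball_kC_unif_open bB.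
near (0:R)^'+ => s; have s0 : 0 < s by [].
have ngV := near_unif_continuous Xcompact (@homeo_inv_continuous _ g) s0.
near (0:R)^'+ => r; exists r => // k hk.
exists (g, e) => //; exists (g^-1 * k)%g; last by rewrite /= mulVKg.
apply: (near near_b s) => // x.
by have := near ngV r _ _ _ (hk x); rewrite /= homeo_funK; exact.
Unshelve. all: by end_near. Qed.

(** The converse, for closed invariant C, is [tau_kCP]. *)
Lemma open_tau_kC W :
  (forall g, W g -> exists2 e, 0 < e & forall b, ball_kC C e b -> W (g * b)%g) ->
  tau_kC C W.
Proof.
move=> W_nbhd.
exists [set p | 0 < p.2 /\ forall b, ball_kC C p.2 b -> W (p.1 * b)%g].
split=> [p []//|]; apply/seteqP; split=> [g /W_nbhd[e e0 gW]|g].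
  by exists (g, e) => //; exists 1%g; [exact: ball_kC1|rewrite mulg1].
by move=> [[h e] /= [e0 hW] [b bB <-]]; exact: hW.
Qed.

Lemma tau_kC_translate g e : 0 < e ->
  tau_kC C [set (g * b)%g | b in ball_kC C e].
Proof.
by move=> e0; exists [set (g, e)]; split; [move=> _ ->|rewrite bigcup_set1].
Qed.

(** If f and g differ, the set where f^-1 g moves points is open and nonempty,
    so it is not contained in C, and at one of its points off C the
    displacement is seen by a translate of a small ball_kC at f. *)
Lemma tau_kC_T0 : closed C -> nowhere_dense C -> is_T0 (tau_kC C).
Proof.
move=> Ccl Cnd f g fg.
have [x fgx] : exists x, (f^-1 * g)%g x != x.
  apply: contrapT => /forallNP fg1; apply: fg; apply: homeoP => x.
  have /negP := fg1 x; rewrite negbK => /eqP /= fgx.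
  by rewrite -[in LHS]fgx homeo_invK.
have [y [fgy nCy]] : exists y, (f^-1 * g)%g y != y /\ ~ C y.
  apply: contrapT => /forallNP CD.
  have : (interior (closure C)) x.
    have mc : continuous (fun z => (f^-1 * g)%g z).
      exact: homeo_fun_continuous.
    rewrite -((closure_id C).1 Ccl); apply/nbhs_mdistE.
    pose d := mdist ((f^-1 * g)%g x) x.
    have d0 : 0 < d by rewrite mdist_gt0.
    have [|t t0 ft] := continuous_mdistP mc x (e := d / 2); first lra.
    exists (Num.min t (d / 2)); first by rewrite lt_min t0; lra.
    move=> y; rewrite lt_min => /andP[/ft mxy xy].
    apply: contrapT => nCy; apply: (CD y); split => //; apply/eqP => my.
    rewrite my in mxy.
    have := metric_triangle ((f^-1 * g)%g x) y x; rewrite (metric_sym y x) -/d.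
    lra.
  by rewrite Cnd.
have [s s0 nCs] := closed_metric_nbhd Ccl nCy.
pose e := Num.min s (mdist ((f^-1 * g)%g y) y).
have e0 : 0 < e by rewrite lt_min s0 mdist_gt0.
exists [set (f * b)%g | b in ball_kC C e]; first exact: tau_kC_translate.
left; split; first by exists 1%g; [exact: ball_kC1|rewrite mulg1].
move=> [b bB fb]; have bE : b = (f^-1 * g)%g by rewrite -fb mulKg.
have es : e <= s by rewrite ge_min lexx.
have [|] := bB y; first by move=> /(metric_nbhd_le es).
by rewrite bE lt_min ltxx andbF.
Qed.

End PartialUniform.

(** * The group topology of an invariant closed set *)

Section InvariantSet.
Variables (R : realType) (X : metricType R).
Hypothesis Xcompact : compact [set: X].
Variable C : set X.
Hypotheses (Cclosed : closed C) (Cinv : homeo_invariant C).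
Implicit Types (f g h b u v : homeo X) (W : set (homeo X)) (r s e : R).

(** This is where invariance enters: a point off C is not sent into C. *)
Lemma near_homeo_avoids h e : 0 < e ->
  \forall r \near 0^'+, forall x, ~ metric_nbhd C e x -> ~ metric_nbhd C r (h x).
Proof.
move=> e0; apply: near_image_avoids => //.
- exact: compact_setC_metric_nbhd.
- exact: homeo_fun_continuous.
move=> x nx; rewrite -{1}(Cinv h) => -[c Cc hcx].
apply: nx; apply: subset_metric_nbhd => //.
by rewrite -(homeo_funK h x) -hcx homeo_funK.
Qed.

(** The inverse [u^-1 b^-1] first applies [b^-1], which may bring points closer
    to C; [near_homeo_avoids] keeps them where u is controlled. *)
Lemma ball_kC_open e b : 0 < e -> ball_kC C e b ->
  exists2 r, 0 < r & forall u, ball_kC C r u -> ball_kC C e (b * u)%g.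
Proof.
move=> e0 bB; have Kc := @compact_setC_metric_nbhd _ _ Xcompact C e.
have nb := near_displacement Kc (@homeo_fun_continuous _ b)
  (fun x nx => (bB x nx).1).
have nbV := near_displacement Kc (@homeo_inv_continuous _ b)
  (fun x nx => (bB x nx).2).
have nbC := near_homeo_avoids (b^-1)%g e0.
near (0:R)^'+ => r; have r0 : 0 < r by [].
have re : r <= e by near: r; exact: nbhs_right_le.
exists r => // u uB x nx; rewrite invgM; split.
  have [|ux _] := uB x; first by move=> /(metric_nbhd_le re).
  by apply: (near nb r _ x nx (u x)) => //; rewrite mdistxx.
have [|_ ubx] := uB ((b^-1)%g x); first exact: (near nbC r).
by apply: (near nbV r _ x nx x) => //; rewrite mdistxx.
Unshelve. all: by end_near. Qed.

(** Compared at x, the conjugate moves x as far as [g^-1] separates [u (g x)]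
    from [g x], and [g x] stays away from C. *)
Lemma ball_kC_conj g e : 0 < e ->
  exists2 r, 0 < r & forall u, ball_kC C r u -> ball_kC C e (g^-1 * u * g)%g.
Proof.
move=> e0.
have ngV := near_unif_continuous Xcompact (@homeo_inv_continuous _ g) e0.
have ngC := near_homeo_avoids g e0.
near (0:R)^'+ => r; have r0 : 0 < r by [].
have conj u x : ball_kC C r u -> ~ metric_nbhd C e x ->
    mdist ((g^-1 * u * g)%g x) x < e.
  move=> uB nx; have [|ugx _] := uB (g x); first exact: (near ngC r).
  by rewrite -[x in mdist _ x](homeo_funK g); apply: (near ngV r).
exists r => // u uB x nx; split; first exact: conj.
by rewrite !invgM invgK mulgA; apply: conj => //; exact: ball_kCV.
Unshelve. all: by end_near. Qed.

Lemma tau_kCP W : tau_kC C W <->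
  forall g, W g -> exists2 e, 0 < e & forall b, ball_kC C e b -> W (g * b)%g.
Proof.
split=> [[I [I0 ->]] _ [[g e] Ige [b bB <-]]|]; last exact: open_tau_kC.
have [r r0 br] := ball_kC_open (I0 _ Ige) bB.
exists r => // u /br buB; exists (g, e) => //; exists (b * u)%g => //.
by rewrite mulgA.
Qed.

Lemma tau_kC_topology : is_topology (tau_kC C).
Proof.
split.
- by apply/tau_kCP => g _; exists 1.
- move=> U V /tau_kCP Uop /tau_kCP Vop; apply/tau_kCP => g [Ug Vg].
  have [r r0 rU] := Uop _ Ug; have [s s0 sV] := Vop _ Vg.
  exists (Num.min r s); first by rewrite lt_min r0.
  move=> b bB; split; [apply: rU|apply: sV]; apply: ball_kC_le bB;
    by rewrite ge_min lexx ?orbT.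
- move=> F Fop; apply/tau_kCP => g [U FU Ug].
  have /tau_kCP/(_ _ Ug)[r r0 rU] := Fop _ FU.
  by exists r => // b /rU; exists U.
Qed.

Lemma tau_kC_group_topology : is_group_topology (tau_kC C).
Proof.
split; first exact: tau_kC_topology.
  move=> W f g /tau_kCP Wop /Wop[e e0 eW].
  have [|r r0 rB] := @ball_kC_conj g (e / 2); first lra.
  exists [set (f * b)%g | b in ball_kC C r],
    [set (g * b)%g | b in ball_kC C (e / 2)]; split.
  - exact: tau_kC_translate.
  - by apply: tau_kC_translate; lra.
  - by exists 1%g; [exact: ball_kC1|rewrite mulg1].
  - by exists 1%g; [apply: ball_kC1; lra|rewrite mulg1].
  - move=> _ _ [u uB <-] [v vB <-].
    have -> : (f * u * (g * v))%g = (f * g * (g^-1 * u * g * v))%g.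
      by rewrite !mulgA mulgK.
    by apply: eW; apply: ball_kCM => //; exact: rB.
move=> W /tau_kCP Wop; apply/tau_kCP => g /= /Wop[e e0 eW].
have [r r0 rB] := ball_kC_conj (g^-1)%g e0.
exists r => // b bB /=.
have -> : ((g * b)^-1)%g = (g^-1 * ((g^-1)^-1 * b^-1 * g^-1))%g.
  by rewrite invgM invgK !mulgA mulVg mul1g.
by apply: eW; apply: rB; exact: ball_kCV.
Qed.

End InvariantSet.

(** * Comparison with the compact-open topology *)

Section Comparison.
Variables (R : realType) (X : metricType R).
Hypothesis Xcompact : compact [set: X].
Variable C : set X.

Lemma ball_k0P e (h : homeo X) : ball_kC set0 e h <->
  forall x, mdist (h x) x < e /\ mdist ((h^-1)%g x) x < e.
Proof.
split=> hB x; last by move=> _; exact: hB.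
by apply: hB => /metric_nbhdP[].
Qed.

(** From left to right: if [ball_kC set0 (e / 2)] is in [tau_kC C], it contains
    some [g * ball_kC C d] through the identity, hence g itself; then
    [h = g^-1 (g h)] is a product of two elements of [ball_kC set0 (e / 2)]
    for every h in [ball_kC C d]. *)
Lemma tau_k_subset_tau_kC :
  tau_k X `<=` tau_kC C <->
  forall e : R, 0 < e -> exists2 d, 0 < d & ball_kC C d `<=` ball_kC set0 e.
Proof.
split=> [kC e e0|small W /(tau_kP Xcompact) Wop].
  have : tau_k X (ball_kC set0 (e / 2)).
    apply/(tau_kP Xcompact) => h /(ball_kC_unif_open Xcompact) nh.
    near (0:R)^'+ => r; exists r; first by [].
    by move=> k hk; exact: (near nh r).
  move=> /kC[I [I0 IE]].
  have [[g d] Igd [b bB gb1]] :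
      (\bigcup_(p in I) [set (p.1 * h)%g | h in ball_kC C p.2]) 1%g.
    by rewrite -IE; apply: ball_kC1; lra.
  have gB : ball_kC set0 (e / 2) g.
    rewrite IE; exists (g, d) => //; exists 1%g; last by rewrite mulg1.
    exact/ball_kC1/(I0 _ Igd).
  exists d; first exact: (I0 _ Igd).
  move=> h hB; rewrite -(mulKg g h); apply: ball_kCM; first exact: ball_kCV.
  by rewrite IE; exists (g, d) => //; exists h.
apply: open_tau_kC => g /Wop[r r0 rW].
have ng := near_unif_continuous Xcompact (@homeo_fun_continuous _ g) r0.
near (0:R)^'+ => e; have [|d d0 dB] := small e; first by [].
exists d => // b /dB/ball_k0P bB; apply: rW => x /=.
by apply: (near ng e) => //; rewrite metric_sym; exact: (bB x).1.
Unshelve. all: by end_near. Qed.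

Lemma ball_kC_subset_ball_k0 :
  (forall e : R, 0 < e ->
     exists2 d, 0 < d & ball_kC C d `<=` ball_kC set0 e) <->
  (forall e : R, 0 < e -> exists d : R, [/\ 0 < d, d <= e &
     forall h : homeo X, ball_kC C d h ->
       forall x, metric_nbhd C d x ->
         mdist (h x) x < e /\ mdist ((h^-1)%g x) x < e]).
Proof.
split=> small e e0.
  have [d d0 dB] := small e e0.
  exists (Num.min d e); split.
  - by rewrite lt_min d0.
  - by rewrite ge_min lexx orbT.
  - move=> h hB x _; have dd : Num.min d e <= d by rewrite ge_min lexx.
    by have /dB/ball_k0P := ball_kC_le dd hB.
have [d [d0 de dC]] := small e e0; exists d => // h hB; apply/ball_k0P => x.
have [Cx|nCx] := pselect (metric_nbhd C d x); first exact: dC.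
by have [? ?] := hB _ nCx; split; exact: lt_le_trans de.
Qed.

End Comparison.

Theorem theorem5 (R : realType) (X : metricType R)
    (Xcompact : compact [set: X]) (C : set X) (Cclosed : closed C) :
  [/\ homeo_invariant C -> is_group_topology (tau_kC C),
      nowhere_dense C -> is_T0 (tau_kC C) &
      tau_kC C `<=` tau_k X /\
      (tau_kC C = tau_k X <->
        forall e : R, 0 < e ->
          exists d : R, [/\ 0 < d, d <= e &
            forall h : homeo X,
              (forall x, ~ metric_nbhd C d x ->
                 mdist (h x) x < d /\ mdist ((h^-1)%g x) x < d) ->
              forall x, metric_nbhd C d x ->
                mdist (h x) x < e /\ mdist ((h^-1)%g x) x < e])].
Proof.
split.
- exact: tau_kC_group_topology.
- exact: tau_kC_T0.
- have kCk := @tau_kC_subset_tau_k _ _ Xcompact C; split=> //.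
  split=> [CE|small].
    by apply/ball_kC_subset_ball_k0/(tau_k_subset_tau_kC Xcompact); rewrite CE.
  apply/seteqP; split=> //.
  exact/(tau_k_subset_tau_kC Xcompact)/ball_kC_subset_ball_k0.
Qed.
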